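(* Let $R$ be a prime ring which is a maximal subring of a ring $T$. Then either $R\cap I\neq 0$ for each nonzero ideal $I$ of $T$, or there exists a nonzero (prime) ideal $I$ of $T$ such that $R\cap I=0$ and one of the following holds: (1) $T$ is a prime ring. In particular, $(R:T)=(R:T)_l=(R:T)_r=0$. (2) $I^2=0$ and $Min_T(0)=\{I\}$. (3) $I^2=I$, $T$ is semiprime, and $Min_T(0)=\{I, ann_T(I)\}$. Moreover, $(R:T)=(R:T)_l=(R:T)_r=ann_T(I)\cap R$.
   Context: All rings are associative and unital (not necessarily commutative), and subrings contain the identity of the big ring; ''ideal'' means two-sided ideal. A maximal subring $R$ of $T$ is a proper subring with no subring strictly between $R$ and $T$. Conductors: $(R:T)=\{x\in T: TxT\subseteq R\}$, $(R:T)_l=\{x\in T: Tx\subseteq R\}$, $(R:T)_r=\{x\in T: xT\subseteq R\}$. $ann_T(I)=\{t\in T: tI=It=0\}$. $Min_T(0)$ is the set of all minimal prime ideals of $T$. *)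

(* Defs.v *)
From mathcomp Require Import all_boot all_algebra.
From mathcomp Require Import boolp classical_sets.

Set Implicit Arguments.
Unset Strict Implicit.
Unset Printing Implicit Defensive.

Import GRing.Theory.

Local Open Scope classical_set_scope.
Local Open Scope ring_scope.

(* Rings are not assumed commutative, and "ideal" means two-sided ideal. The   *)
(* ideal-theoretic notions are relative to a subring S of the ambient ring T,  *)
(* so that they apply both to a proper subring and, with S = [set: T], to T.   *)
Section Rings.
Context {T : pzRingType}.
Implicit Types (S R A B I P : set T).

Definition subring R : Prop := GRing.subring_closed [in R].

Definition maximal_subring R : Prop :=
  [/\ subring R, R <> [set: T] &
      forall S, subring S -> R `<=` S -> S = R \/ S = [set: T]].

Definition ideal S I : Prop :=
  [/\ I `<=` S, GRing.zmod_closed [in I] &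
      forall s x, S s -> I x -> I (s * x) /\ I (x * s)].

(* the finite sums of products a * b with a in A and b in B *)
Definition ideal_mul A B : set T :=
  [set x | exists n (a b : 'I_n -> T),
     [/\ forall i, A (a i), forall i, B (b i) & x = \sum_(i < n) a i * b i]].

Definition prime_ideal S P : Prop :=
  [/\ ideal S P, P <> S &
      forall A B, ideal S A -> ideal S B ->
        ideal_mul A B `<=` P -> A `<=` P \/ B `<=` P].

Definition prime_ring S : Prop := prime_ideal S [set 0].

Definition semiprime_ideal S P : Prop :=
  ideal S P /\ forall A, ideal S A -> ideal_mul A A `<=` P -> A `<=` P.

Definition semiprime_ring S : Prop := semiprime_ideal S [set 0].

(* Min_S(0): every ideal contains 0, so no lower bound needs to be imposed *)
Definition min_primes S : set (set T) :=
  [set P | prime_ideal S P /\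
           forall Q, prime_ideal S Q -> Q `<=` P -> Q = P].

Definition ann I : set T := [set t | forall x, I x -> t * x = 0 /\ x * t = 0].

(* (R : T), (R : T)_l and (R : T)_r; for an additive subgroup R it does not    *)
(* matter whether T x T denotes the products s x t or their finite sums.       *)
Definition conductor R : set T := [set x | forall s t : T, R (s * x * t)].
Definition conductor_l R : set T := [set x | forall t : T, R (t * x)].
Definition conductor_r R : set T := [set x | forall t : T, R (x * t)].

End Rings.

(* Main.v *)
Require Import Defs.
From mathcomp Require Import all_boot all_algebra.
From mathcomp Require Import boolp classical_sets.

(** An ideal [I <> 0] of [T] with [R `&` I = 0] satisfies [T = R + I] by
    maximality of [R]; hence [T / I] is isomorphic to [R], so [I] is prime, and
    [I] is a minimal ideal by the modular law. If [I^2 = 0], every prime ideal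
    contains [I]. Otherwise [I^2 = I], every ideal of [T] either contains [I] or
    annihilates it, and so [ann I] is a prime ideal meeting [I] trivially:
    [T] is prime if [ann I = 0], and otherwise [I] and [ann I] are the two
    minimal primes. A conductor is contained in [R] and multiplies [I] into
    [R `&` I = 0] on one side; this forces it into [ann I]. *)

Set Implicit Arguments.
Unset Strict Implicit.
Unset Printing Implicit Defensive.

Import GRing.Theory.

Local Open Scope classical_set_scope.
Local Open Scope ring_scope.

(** * Two-sided ideals: closure, products and annihilators *)

Section Ideals.
Context {T : pzRingType}.
Implicit Types (S R A B C I J P : set T).

(** The closure conditions behind [subring] speak of boolean membership; this form trades it for
    plain propositions. *)
Lemma subringP R : subring R <->
  [/\ R 1, forall x y, R x -> R y -> R (x - y)
    & forall x y, R x -> R y -> R (x * y)].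
Proof.
split=> [[R1 RB RM]|[R1 RB RM]]; split=> [|x y|x y]; rewrite ?unfold_in /= ?inE //.
- by move: R1; rewrite unfold_in /= inE.
- by move=> Rx Ry; have := RB x y; rewrite !unfold_in /= !inE; apply.
- by move=> Rx Ry; have := RM x y; rewrite !unfold_in /= !inE; apply.
- by move=> /RB; apply.
- by move=> /RM; apply.
Qed.

Lemma idealP S I : ideal S I <->
  [/\ I `<=` S, I 0, forall x y, I x -> I y -> I (x - y)
    & forall s x, S s -> I x -> I (s * x) /\ I (x * s)].
Proof.
split=> [[IS [I0 IB] IM]|[IS I0 IB IM]]; split=> //.
- by move: I0; rewrite unfold_in /= inE.
- by move=> x y Ix Iy; have := IB x y; rewrite !unfold_in /= !inE; apply.
- by split=> [|x y]; rewrite !unfold_in /= !inE //; apply: IB.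
Qed.

Lemma ideal0 S I : ideal S I -> I 0.
Proof. by case/idealP. Qed.

Lemma idealB S I x y : ideal S I -> I x -> I y -> I (x - y).
Proof. by case/idealP=> _ _ IB _; apply: IB. Qed.

Lemma idealN S I x : ideal S I -> I x -> I (- x).
Proof. by move=> hI Ix; rewrite -sub0r; exact: idealB hI (ideal0 hI) Ix. Qed.

Lemma idealD S I x y : ideal S I -> I x -> I y -> I (x + y).
Proof. by move=> hI Ix Iy; rewrite -[y]opprK; exact: idealB hI Ix (idealN hI Iy). Qed.

Lemma idealMl I s x : ideal [set: T] I -> I x -> I (s * x).
Proof. by case=> _ _ IM Ix; have [] := IM s x Logic.I Ix. Qed.

Lemma idealMr I s x : ideal [set: T] I -> I x -> I (x * s).
Proof. by case=> _ _ IM Ix; have [] := IM s x Logic.I Ix. Qed.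

Lemma idealI S I J : ideal S I -> ideal S J -> ideal S (I `&` J).
Proof.
move=> /idealP[IS I0 IB IM] /idealP[_ J0 JB JM]; apply/idealP; split=> //.
- by move=> x [/IS].
- by move=> x y [Ix Jx] [Iy Jy]; split; [apply: IB|apply: JB].
- move=> s x Ss [Ix Jx].
  by have [? ?] := IM s x Ss Ix; have [? ?] := JM s x Ss Jx.
Qed.

Lemma ideal_neq0 I : ideal [set: T] I -> I <> [set 0] -> exists2 x, I x & x <> 0.
Proof.
move=> hI I_neq0; apply: contrapT => hn; apply: I_neq0.
apply/seteqP; split=> [x Ix|_ ->]; last exact: ideal0 hI.
by apply: contrapT => x_neq0; apply: hn; exists x.
Qed.

Lemma mem_ideal_mul A B x y : A x -> B y -> ideal_mul A B (x * y).
Proof.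
by move=> Ax By; exists 1%N, (fun=> x), (fun=> y); split; rewrite ?big_ord1.
Qed.

Lemma ideal_mul_sub S A B C : ideal S C ->
  (forall x y, A x -> B y -> C (x * y)) -> ideal_mul A B `<=` C.
Proof.
move=> hC hAB _ [n [a [b [Aa Bb ->]]]].
by apply: (big_ind C) => [|x y|i _]; [apply: ideal0 hC|apply: idealD hC|apply: hAB].
Qed.

Lemma ideal_mul_ideal S A B : ideal S A -> ideal S B -> ideal S (ideal_mul A B).
Proof.
move=> hA hB; have [AS _ AM] := hA; have [BS _ BM] := hB.
apply/idealP; split.
- apply: subset_trans AS; apply: (ideal_mul_sub hA) => x y Ax /BS Sy.
  by have [] := AM y x Sy Ax.
- by exists 0%N, (fun=> 0), (fun=> 0); split; rewrite ?big_ord0 // => -[].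
- move=> _ _ [n [a [b [Aa Bb ->]]]] [m [c [d [Ac Bd ->]]]].
  (* The two families are concatenated over ['I_(n + m)]; the minus sign goes into the left factors
     of the second. *)
  exists (n + m)%N, (fun i => match split i with inl j => a j | inr j => - c j end),
    (fun i => match split i with inl j => b j | inr j => d j end); split.
  + by move=> i; case: split => j //; exact: idealN hA (Ac j).
  + by move=> i; case: split.
  + rewrite big_split_ord -sumrN; congr (_ + _); apply: eq_bigr => i _.
      by rewrite -[lshift m i]/(unsplit (inl i)) unsplitK.
    by rewrite -[rshift n i]/(unsplit (inr i)) unsplitK mulNr.
- move=> s _ Ss [n [a [b [Aa Bb ->]]]]; split.
    exists n, (fun i => s * a i), b; split=> [i|//|].
      by have [] := AM s (a i) Ss (Aa i).
    by rewrite mulr_sumr; apply: eq_bigr => i _; rewrite mulrA.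
  exists n, a, (fun i => b i * s); split=> [//|i|].
    by have [] := BM s (b i) Ss (Bb i).
  by rewrite mulr_suml; apply: eq_bigr => i _; rewrite mulrA.
Qed.

Lemma ideal_zero : ideal [set: T] [set 0].
Proof.
apply/idealP; split=> // [x y -> ->|s x _ ->]; first by rewrite /= subr0.
by rewrite /= mulr0 mul0r.
Qed.

Lemma lann_ideal I : ideal [set: T] I ->
  ideal [set: T] [set t | forall x, I x -> t * x = 0].
Proof.
move=> hI; apply/idealP; split=> // [x _|x y hx hy z Iz|s x _ hx].
- exact: mul0r.
- by rewrite mulrBl hx // hy // subr0.
- split=> z Iz; first by rewrite -mulrA hx ?mulr0.
  by rewrite -mulrA hx //; apply: idealMl.
Qed.

Lemma rann_ideal I : ideal [set: T] I ->
  ideal [set: T] [set t | forall x, I x -> x * t = 0].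
Proof.
move=> hI; apply/idealP; split=> // [x _|x y hx hy z Iz|s x _ hx].
- exact: mulr0.
- by rewrite mulrBr hx // hy // subr0.
- split=> z Iz; last by rewrite mulrA hx ?mul0r.
  by rewrite mulrA hx //; apply: idealMr.
Qed.

Lemma ann_ideal I : ideal [set: T] I -> ideal [set: T] (ann I).
Proof.
move=> hI; have := idealI (lann_ideal hI) (rann_ideal hI).
congr ideal; apply/seteqP; split=> t /=.
  by move=> [lt rt] x Ix; split; [apply: lt|apply: rt].
by move=> at_; split=> x /at_ [].
Qed.

End Ideals.

(** * Nonzero idempotent minimal ideals *)

Section IdempotentMinimalIdeal.
Context {T : pzRingType} (I : set T).
Context (I_ideal : ideal [set: T] I).
Context (I_neq0 : I <> [set 0]).
Context (I_minimal : forall J, ideal [set: T] J -> J `<=` I -> J <> [set 0] -> J = I).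
Context (I_idem : ideal_mul I I = I).

Lemma minimal_idem_not_nil : ~ forall x y, I x -> I y -> x * y = 0.
Proof.
move=> II0; apply: I_neq0; apply/seteqP; split=> [|_ ->]; last exact: ideal0 I_ideal.
by rewrite -I_idem; apply: (ideal_mul_sub ideal_zero) => x y Ix Iy; exact: II0.
Qed.

(** By minimality, the intersection of [J] and [I] is zero or [I]. If it is zero, so are the
    products [t * x] and [x * t] with [t] in [J] and [x] in [I], which lie in it. *)
Lemma minimal_sub_or_ann (J : set T) : ideal [set: T] J -> I `<=` J \/ J `<=` ann I.
Proof.
move=> hJ; have hJI := idealI hJ I_ideal.
have [JI0|/(I_minimal hJI)] := EM (J `&` I = [set 0]); last first.
  by move=> <-; [left=> x []|move=> x []].
right=> t Jt x Ix; split.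
  have : (J `&` I) (t * x) by split; [apply: idealMr|apply: idealMl].
  by rewrite JI0.
have : (J `&` I) (x * t) by split; [apply: idealMl|apply: idealMr].
by rewrite JI0.
Qed.

(** The left annihilator of [I] is a two-sided ideal, so the dichotomy applies to it; it cannot
    contain [I], since products in [I] are not all zero. *)
Lemma lann_sub_ann t : (forall x, I x -> t * x = 0) -> ann I t.
Proof.
have [Isub|Jsub] := minimal_sub_or_ann (lann_ideal I_ideal); last exact: Jsub.
by case: minimal_idem_not_nil => x y /Isub; apply.
Qed.

Lemma rann_sub_ann t : (forall x, I x -> x * t = 0) -> ann I t.
Proof.
have [Isub|Jsub] := minimal_sub_or_ann (rann_ideal I_ideal); last exact: Jsub.
by case: minimal_idem_not_nil => x y Ix /Isub; apply.
Qed.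

Lemma minimal_not_sub_ann : ~ I `<=` ann I.
Proof.
by move=> IA; apply: minimal_idem_not_nil => x y /IA Ax /Ax [].
Qed.

Lemma minimal_cap_ann : I `&` ann I = [set 0].
Proof.
apply: contrapT => /(I_minimal (idealI I_ideal (ann_ideal I_ideal))) IA.
by apply: minimal_not_sub_ann; rewrite -{1}IA => [x []|x []].
Qed.

(** An ideal not contained in [ann I] contains [I]; the product of two such ideals contains the
    square of [I], which is [I] and does not annihilate itself. *)
Lemma ann_prime : prime_ideal [set: T] (ann I).
Proof.
split; first exact: ann_ideal.
  by move=> AT; apply: minimal_not_sub_ann; rewrite AT.
move=> J K hJ hK JK.
have [IJ|] := minimal_sub_or_ann hJ; last by left.
have [IK|] := minimal_sub_or_ann hK; last by right.
case: minimal_not_sub_ann; rewrite -{1}I_idem.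
apply: (ideal_mul_sub (ann_ideal I_ideal)) => x y /IJ Jx /IK Ky.
exact/JK/mem_ideal_mul.
Qed.

(** Zero is the intersection of the prime ideals [I] and [ann I], and a prime ideal containing the
    square of an ideal contains that ideal. *)
Lemma minimal_semiprime : prime_ideal [set: T] I -> semiprime_ring [set: T].
Proof.
move=> [_ _ I_prime]; split; first exact: ideal_zero.
have [_ _ A_prime] := ann_prime.
move=> J hJ JJ0; rewrite -minimal_cap_ann => x Jx; split.
  have : J `<=` I by case: (I_prime J J) => // y /JJ0 ->; apply: ideal0 I_ideal.
  exact.
have : J `<=` ann I.
  by case: (A_prime J J) => // y /JJ0 ->; apply: ideal0 (ann_ideal I_ideal).
exact.
Qed.

(** Since [I] and [ann I] multiply to zero, every prime ideal contains one of them; neither contains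
    the other, so both are minimal. *)
Lemma minimal_min_primes : prime_ideal [set: T] I -> ann I <> [set 0] ->
  min_primes [set: T] = [set I; ann I].
Proof.
move=> I_prime A_neq0.
have I_or_A Q : prime_ideal [set: T] Q -> I `<=` Q \/ ann I `<=` Q.
  move=> [hQ _ Q_prime]; apply: Q_prime => //; first exact: ann_ideal.
  by apply: (ideal_mul_sub hQ) => x y Ix /(_ x Ix) [_ ->]; apply: ideal0 hQ.
have AnI : ~ ann I `<=` I.
  move=> AI; apply: A_neq0.
  by rewrite -minimal_cap_ann; apply/seteqP; split=> x => [Ax|[]]; first by split; [apply: AI|].
apply/seteqP; split=> [P [P_prime P_min]|P [->|->]].
- have [IP|AP] := I_or_A P P_prime; [left|right]; apply/esym/P_min => //.
  exact: ann_prime.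
- split=> // Q Q_prime QI; apply/seteqP; split=> //.
  by have [//|AQ] := I_or_A Q Q_prime; case: AnI; apply: subset_trans QI.
- split; first exact: ann_prime.
  move=> Q Q_prime QA; apply/seteqP; split=> //.
  have [IQ|//] := I_or_A Q Q_prime.
  by case: minimal_not_sub_ann; apply: subset_trans QA.
Qed.

End IdempotentMinimalIdeal.

(** * Ideals meeting a maximal subring trivially *)

Section ComplementedSubring.
Context {T : pzRingType} (R I : set T).
Context (R_maximal : maximal_subring R).
Context (I_ideal : ideal [set: T] I).
Context (I_neq0 : I <> [set 0]).
Context (RI0 : R `&` I = [set 0]).

(** The sums [r + x] form a subring above [R]; were it equal to [R], the nonzero ideal [I] would lie
    inside [R]. *)
Lemma maximal_add_ideal (t : T) : exists r x, [/\ R r, I x & t = r + x].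
Proof.
have [/subringP[R1 RB RM] _ R_max] := R_maximal.
have R0 : R 0 by rewrite -(subrr 1); apply: RB.
have I0 := ideal0 I_ideal.
pose S : set T := [set t | exists r x, [/\ R r, I x & t = r + x]].
suff ST : S = [set: T] by have : S t by rewrite ST.
have S_subring : subring S.
  apply/subringP; split; first by exists 1, 0; rewrite addr0.
    move=> _ _ [r [x [Rr Ix ->]]] [s [y [Rs Iy ->]]].
    exists (r - s), (x - y); split; [exact: RB|exact: idealB I_ideal Ix Iy|].
    by rewrite opprD addrACA.
  move=> _ _ [r [x [Rr Ix ->]]] [s [y [Rs Iy ->]]].
  exists (r * s), (r * y + x * (s + y)); split; first exact: RM.
    by apply: (idealD I_ideal); [apply: idealMl|apply: idealMr].
  by rewrite mulrDl mulrDr addrA.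
have RS : R `<=` S by move=> r Rr; exists r, 0; rewrite addr0.
have [SR|//] := R_max S S_subring RS.
have [x Ix x_neq0] := ideal_neq0 I_ideal I_neq0.
have Rx : R x by rewrite -SR; exists 0, x; rewrite add0r.
by have : (R `&` I) x by []; rewrite RI0 => /x_neq0.
Qed.

Lemma complement_prime : prime_ring R -> prime_ideal [set: T] I.
Proof.
move=> [_ R_neq0 R_prime].
have [/subringP[R1 RB RM] _ _] := R_maximal.
have R0 : R 0 by rewrite -(subrr 1); apply: RB.
have I0 := ideal0 I_ideal.
split=> //.
  move=> IT; apply: R_neq0; rewrite -RI0 IT; exact: setIT.
(* No quotient ring is built: [proj J] is the trace on [R] of the sum of [J] and [I], that is, the
   image of [J] modulo [I] read in [R]. *)
pose proj J := [set r | R r /\ exists2 x, I x & J (r + x)].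
have proj_ideal J : ideal [set: T] J -> ideal R (proj J).
  move=> hJ; apply/idealP; split=> [r []//||r s [Rr [x Ix Jx]] [Rs [y Iy Jy]]|].
  - by split=> //; exists 0 => //; rewrite addr0; apply: ideal0 hJ.
  - split; first exact: RB.
    exists (x - y); first exact: idealB I_ideal Ix Iy.
    by rewrite addrACA -opprD; exact: idealB hJ Jx Jy.
  - move=> s r Rs [Rr [x Ix Jx]]; split; (split; first exact: RM).
      by exists (s * x); [apply: idealMl|rewrite -mulrDr; apply: idealMl].
    by exists (x * s); [apply: idealMr|rewrite -mulrDl; apply: idealMr].
have proj0 J : proj J `<=` [set 0] -> J `<=` I.
  move=> J0 t Jt; have [r [x [Rr Ix def_t]]] := maximal_add_ideal t.
  have /J0 r0 : proj J r.
    by split=> //; exists x => //; rewrite -def_t.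
  by rewrite def_t r0 add0r.
move=> J K hJ hK JK.
have [||JK0|/proj0|/proj0] := R_prime (proj J) (proj K); [exact: proj_ideal..| |by left|by right].
have hz : ideal R [set 0].
  apply/idealP; split=> // [_ ->//|x y -> ->|s x _ ->]; first by rewrite /= subr0.
  by rewrite /= mulr0 mul0r.
apply: (ideal_mul_sub hz) => r s [Rr [x Ix Jx]] [Rs [y Iy Ky]].
rewrite -RI0; split; first exact: RM.
have /JK : ideal_mul J K ((r + x) * (s + y)) by apply: mem_ideal_mul.
(* These are the terms of [(r + x) * (s + y)] other than [r * s]; removing them shows that [r * s]
   lies in [I]. *)
have : I (r * y + x * (s + y)).
  by apply: (idealD I_ideal); [apply: idealMl|apply: idealMr].
move=> Iz Irs; have := idealB I_ideal Irs Iz.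
by rewrite mulrDl [r * _]mulrDr -(addrA (r * s)) addrK.
Qed.

End ComplementedSubring.

(** A nonzero ideal [J] inside [I] also meets [R] trivially, so [T] is the sum of [R] and [J]; the
    [R]-component of an element of [I] then lies in [I] too, hence vanishes. *)
Lemma complement_minimal (T : pzRingType) (R I : set T) :
  maximal_subring R -> ideal [set: T] I -> R `&` I = [set 0] ->
  forall J, ideal [set: T] J -> J `<=` I -> J <> [set 0] -> J = I.
Proof.
move=> R_maximal I_ideal RI0 J J_ideal JI J_neq0.
apply/seteqP; split=> // t It.
have [R0 _] : (R `&` I) 0 by rewrite RI0.
have RJ0 : R `&` J = [set 0].
  apply/seteqP; split=> [x [Rx /JI Ix]|_ ->]; first by rewrite -RI0.
  by split=> //; apply: ideal0 J_ideal.
have [r [x [Rr Jx def_t]]] := maximal_add_ideal R_maximal J_ideal J_neq0 RJ0 t.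
have : (R `&` I) r.
  split=> //; have -> : r = t - x by rewrite def_t addrK.
  by apply: (idealB I_ideal) => //; apply: JI.
by rewrite RI0 def_t => ->; rewrite add0r.
Qed.

(** Multiplying [I] by a conductor element on one side lands in both [R] and [I], and one-sided
    annihilation of [I] is two-sided. Conversely, in a product of [t = r + y] with an element of
    [ann I] and [R], the part [y] dies and the rest stays in [R]. *)
Lemma complement_conductors (T : pzRingType) (R I : set T) :
  maximal_subring R -> ideal [set: T] I -> I <> [set 0] -> R `&` I = [set 0] ->
  ideal_mul I I = I ->
  [/\ conductor R = ann I `&` R, conductor_l R = ann I `&` R
    & conductor_r R = ann I `&` R].
Proof.
move=> R_maximal I_ideal I_neq0 RI0 I_idem.
have I_min := complement_minimal R_maximal I_ideal RI0.
have [/subringP[R1 RB RM] _ _] := R_maximal.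
have dec := maximal_add_ideal R_maximal I_ideal I_neq0 RI0.
have RI x : R x -> I x -> x = 0 by move=> Rx Ix; have : (R `&` I) x by []; rewrite RI0.
have mulRl x t : (ann I `&` R) x -> R (t * x).
  move=> [Ax Rx]; have [r [y [Rr Iy ->]]] := dec t.
  by rewrite mulrDl (Ax y Iy).2 addr0; apply: RM.
have mulRr x t : (ann I `&` R) x -> R (x * t).
  move=> [Ax Rx]; have [r [y [Rr Iy ->]]] := dec t.
  by rewrite mulrDr (Ax y Iy).1 addr0; apply: RM.
have subl : conductor_l R `<=` ann I `&` R.
  move=> x Lx; split; last by rewrite -[x]mul1r.
  apply: (rann_sub_ann I_ideal I_neq0 I_min I_idem) => y Iy.
  by apply: RI (Lx y) _; apply: idealMr.
have subr : conductor_r R `<=` ann I `&` R.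
  move=> x Lx; split; last by rewrite -[x]mulr1.
  apply: (lann_sub_ann I_ideal I_neq0 I_min I_idem) => y Iy.
  by apply: RI (Lx y) _; apply: idealMl.
split; apply/seteqP; split=> //.
(* Taking the right-hand factor to be one places [conductor R] inside [conductor_l R]. *)
- by move=> x Cx; apply: subl => t; rewrite -[_ * _]mulr1.
- move=> x Ax s t; have [r [y [Rr Iy ->]]] := dec t.
  rewrite mulrDr -!mulrA (Ax.1 y Iy).1 mulr0 addr0 mulrA.
  exact: RM (mulRl _ _ Ax) Rr.
- by move=> x Ax t; apply: mulRl.
- by move=> x Ax t; apply: mulRr.
Qed.

Lemma nil_min_primes (T : pzRingType) (I : set T) :
  prime_ideal [set: T] I -> ideal_mul I I = [set 0] ->
  min_primes [set: T] = [set I].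
Proof.
move=> I_prime II0; have [I_ideal _ _] := I_prime.
have I_sub Q : prime_ideal [set: T] Q -> I `<=` Q.
  move=> [hQ _ Q_prime]; case: (Q_prime I I) => //.
  by rewrite II0 => _ ->; apply: ideal0 hQ.
apply/seteqP; split=> [P [P_prime P_min]|_ ->].
  by apply/esym/P_min => //; apply: I_sub.
by split=> // Q Q_prime QI; apply/seteqP; split=> //; apply: I_sub.
Qed.

(** * Trichotomy by the square and the annihilator of [I] *)

Theorem theorem2p8 (T : pzRingType) (R : set T)
    (R_maximal : maximal_subring R) (R_prime : prime_ring R) :
  (forall I : set T, ideal [set: T] I -> I <> [set 0] -> R `&` I <> [set 0])
  \/
  (exists I : set T,
    [/\ prime_ideal [set: T] I, I <> [set 0], R `&` I = [set 0] &
      [\/ prime_ring [set: T] /\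
          [/\ conductor R = [set 0], conductor_l R = [set 0]
            & conductor_r R = [set 0]],
          ideal_mul I I = [set 0] /\ min_primes [set: T] = [set I]
        | [/\ ideal_mul I I = I, semiprime_ring [set: T],
              min_primes [set: T] = [set I; ann I] &
              [/\ conductor R = ann I `&` R, conductor_l R = ann I `&` R
                & conductor_r R = ann I `&` R]]]]).
Proof.
have [|noI] := EM (exists I, [/\ ideal [set: T] I, I <> [set 0] & R `&` I = [set 0]]);
  last by left=> I hI I_neq0 RI0; apply: noI; exists I.
move=> [I [I_ideal I_neq0 RI0]]; right; exists I.
have I_prime := complement_prime R_maximal I_ideal I_neq0 RI0 R_prime.
have I_min := complement_minimal R_maximal I_ideal RI0.
split=> //.
have [II0|II_neq0] := EM (ideal_mul I I = [set 0]).
  by apply: Or32; split=> //; apply: nil_min_primes.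
have I_idem : ideal_mul I I = I.
  apply: I_min => //; first exact: ideal_mul_ideal.
  by apply: (ideal_mul_sub I_ideal) => x y Ix _; apply: idealMr.
have cond := complement_conductors R_maximal I_ideal I_neq0 RI0 I_idem.
have A_prime := ann_prime I_ideal I_neq0 I_min I_idem.
have [A0|A_neq0] := EM (ann I = [set 0]).
  (* The zero ideal is now the prime ideal [ann I], and the common value of the three conductors
     collapses to zero. *)
  apply: Or31; split; first by rewrite /prime_ring -A0.
  suff A0R : ann I `&` R = [set 0] by move: cond; rewrite A0R.
  have [R0 _] : (R `&` I) 0 by rewrite RI0.
  by rewrite A0; apply/seteqP; split=> [x []|_ ->].
apply: Or33; split=> //; first exact: minimal_semiprime I_prime.
exact: minimal_min_primes.
Qed.
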